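(* A set $E\subseteq\mathbb{R}$ is monotone $\operatorname{Lip}1$ if and only if $E$ is weakly dense and its complement $E^c=\mathbb{R}\setminus E$ is strongly dense.
   Context: For a continuous $f:\mathbb{R}\to\mathbb{R}$, $x\in\mathbb{R}$ and $r>0$ put $M_f(x,r)=\frac{1}{r}\sup\{|f(x)-f(y)|:|x-y|\le r\}$ and $\operatorname{Lip} f(x)=\limsup_{r\to0^+}M_f(x,r)$. A set $E\subseteq\mathbb{R}$ is monotone $\operatorname{Lip}1$ if there is a continuous, monotone function $f:\mathbb{R}\to\mathbb{R}$ with $\operatorname{Lip} f=\mathbf{1}_E$ (the characteristic function of $E$). $|A|$ denotes the Lebesgue measure of $A$. For a sequence of non-degenerate closed intervals $\{I_n\}$, write $I_n\to x$ if $x\in I_n$ for all $n\in\mathbb{N}$ and $|I_n|\to0$. A measurable set $S$ is weakly dense at $x$ if there exists $I_n\to x$ with $\frac{|S\cap I_n|}{|I_n|}\to1$, and strongly dense at $x$ if $\frac{|S\cap I_n|}{|I_n|}\to1$ for every sequence $\{I_n\}$ with $I_n\to x$. $S$ is weakly (strongly) dense if it is weakly (strongly) dense at every $x\in S$; these properties include measurability of $S$. *)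

(* Defs.v *)
From HB Require Import structures.
From mathcomp Require Import all_boot all_order all_algebra.
From mathcomp Require Import all_classical all_reals all_analysis.
Set Implicit Arguments.
Unset Strict Implicit.
Unset Printing Implicit Defensive.
Import Order.TTheory GRing.Theory Num.Theory.
Import numFieldNormedType.Exports.
Local Open Scope classical_set_scope.
Local Open Scope ring_scope.

(* The supremum and the limsup are taken in \bar R, so that Lip f x = +oo is
   a possible value; for continuous f and 0 < r, M_ f x r is a real number. *)
Definition M_ (R : realType) (f : R -> R) (x r : R) : \bar R :=
  (r^-1%:E * ereal_sup [set `|f x - f y|%:E | y in [set y | (`|x - y| <= r)%R]])%E.

Definition Lip (R : realType) (f : R -> R) (x : R) : \bar R :=
  limf_esup (M_ f x) 0^'+.

Definition monotone_fun (R : realType) (f : R -> R) : Prop :=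
  {homo f : x y / x <= y} \/ {homo f : x y / x <= y >-> y <= x}.

Definition monotone_Lip1 (R : realType) (E : set R) : Prop :=
  exists f : R -> R,
    [/\ continuous f, monotone_fun f & forall x, Lip f x = (\1_E x)%:E].

(* The canonical measurable structure on R is the Borel one. Lebesgue
   measurability is Caratheodory measurability with respect to the outer
   measure generated by interval length; these sets form the domain of
   completed_lebesgue_measure. *)
Definition Lebesgue_measurable (R : realType) (S : set R) : Prop :=
  (wlength (@idfun R))^*%mu.-cara.-measurable S.

Definition Lebesgue (R : realType) (S : set R) : \bar R :=
  completed_lebesgue_measure S.

Definition closed_interval (R : realType) (J : set R) : Prop :=
  exists a b : R, a < b /\ J = `[a, b]%classic.

Definition intervals_to (R : realType) (I : (set R)^nat) (x : R) : Prop :=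
  [/\ forall n, closed_interval (I n),
      forall n, I n x &
      Lebesgue (I n) @[n --> \oo] --> 0%E].

(* The quotients are real numbers for 0 < Lebesgue (I n) < +oo. *)
Definition density_to1 (R : realType) (S : set R) (I : (set R)^nat) : Prop :=
  (Lebesgue (S `&` I n) / Lebesgue (I n))%E @[n --> \oo] --> 1%E.

Definition weakly_dense_at (R : realType) (S : set R) (x : R) : Prop :=
  exists I : (set R)^nat, intervals_to I x /\ density_to1 S I.

Definition strongly_dense_at (R : realType) (S : set R) (x : R) : Prop :=
  forall I : (set R)^nat, intervals_to I x -> density_to1 S I.

Definition weakly_dense (R : realType) (S : set R) : Prop :=
  Lebesgue_measurable S /\ forall x, S x -> weakly_dense_at S x.

Definition strongly_dense (R : realType) (S : set R) : Prop :=
  Lebesgue_measurable S /\ forall x, S x -> strongly_dense_at S x.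

(* Main.v *)
Require Import Defs.
From HB Require Import structures.
From mathcomp Require Import all_boot all_order all_algebra.
From mathcomp Require Import all_classical all_reals all_analysis.
From mathcomp Require Import measurable_realfun lra.
Set Implicit Arguments.
Unset Strict Implicit.
Unset Printing Implicit Defensive.
Import Order.TTheory GRing.Theory Num.Theory.
Import numFieldNormedType.Exports.
Local Open Scope classical_set_scope.
Local Open Scope ring_scope.

(* If F is a primitive of the indicator of E, i.e. F b - F a = |E `&` [a, b]|
   for a <= b, then F is nondecreasing and 1-Lipschitz, and at every x
     Lip F x <= 0  <->  the complement of E is strongly dense at x,
     1 <= Lip F x  <->  E is weakly dense at x.
   So it is enough to show that a nondecreasing f with Lip f = \1_E is such a
   primitive. As Lip f <= 1, both f and id - f are nondecreasing, and Lebesgue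
   measure is the sum of their Stieltjes measures nu and nu'. Small intervals
   around the points of ~` E (resp. of E) have arbitrarily small nu-ratio (resp.
   nu'-ratio), so nu (~` E) = 0 and nu' E = 0 by Vitali's covering theorem, and
   |E `&` [a, b]| = nu (E `&` [a, b]) = nu [a, b] = f b - f a. *)

(** * Epsilon-delta forms of bounds on [Lip] *)

Section LipE.
Context {R : realType}.
Implicit Types (f : R -> R) (x y r c e d : R).

Lemma le_M_ f x y : x != y -> ((`|f x - f y| / `|x - y|)%R%:E <= M_ f x `|x - y|%R)%E.
Proof.
move=> xy; rewrite mulrC EFinM /M_ lee_pmul2l ?lte_fin ?invr_gt0 ?normr_gt0 ?subr_eq0//.
by apply: ereal_sup_ubound; exists y => //=.
Qed.

Lemma M__le f x r c : 0 < r -> 0 <= c ->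
  (forall y, `|x - y| <= r -> `|f x - f y| <= c * `|x - y|) -> (M_ f x r <= c%:E)%E.
Proof.
move=> r0 c0 H; rewrite /M_ lee_pdivrMl// -EFinM.
apply: ge_ereal_sup => _ [y /= yr <-]; rewrite lee_fin.
by rewrite (le_trans (H _ yr))// mulrC ler_wpM2r.
Qed.

(** The supremum in [M_] can be traded for single quotients: the quotient at [y] is at most [M_ f x]
    at radius [|x - y|], and a bound on all quotients with [|x - y| < d] bounds [M_ f x r] for every
    [r < d]. *)
Lemma Lip_leP f x c : 0 <= c ->
  (Lip f x <= c%:E)%E <->
  (forall e, 0 < e -> exists2 d, 0 < d &
     forall y, `|x - y| < d -> `|f x - f y| <= (c + e) * `|x - y|).
Proof.
move=> c0; split=> [fc e e0|H].
  have : (Lip f x < (c + e)%R%:E)%E by rewrite (le_lt_trans fc)// lte_fin ltrDl.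
  move=> /ereal_inf_lt[_ [V [d /= d0 dV] <-] Vc].
  exists d => // y yd; have [->|xy] := eqVneq x y; first by rewrite !subrr normr0 mulr0.
  have xy0 : 0 < `|x - y| by rewrite normr_gt0 subr_eq0.
  rewrite -ler_pdivrMr// -lee_fin (le_trans (le_M_ f xy))//.
  apply/ltW/(le_lt_trans _ Vc)/ereal_sup_ubound; exists `|x - y| => //.
  by apply: dV => //=; rewrite sub0r normrN normr_id.
apply/lee_addgt0Pr => e e0; have [d d0 dH] := H e e0.
apply: (@le_trans _ _ (ereal_sup (M_ f x @` [set r | 0 < r < d]))).
  apply: ereal_inf_lbound; exists [set r | 0 < r < d] => //.
  by exists d => //= r /=; rewrite sub0r normrN => + r0; rewrite gtr0_norm// r0 => ->.
apply: ge_ereal_sup => _ [r /= /andP[r0 rd] <-].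
apply: M__le => //; first by rewrite addr_ge0// ltW.
by move=> y yr; apply: dH; exact: le_lt_trans rd.
Qed.

(** A point [y] that nearly attains the supremum at radius [r] has increment above [(c - e) * r],
    which dominates [(c - e) * |x - y|] because [c - e] is nonnegative. Conversely such a [y] is
    tested at the radius [|x - y|]. *)
Lemma Lip_geP f x c : 0 < c ->
  (c%:E <= Lip f x)%E <->
  (forall e, 0 < e < c -> forall d, 0 < d ->
     exists y, [/\ y != x, `|x - y| < d & (c - e) * `|x - y| <= `|f x - f y|]).
Proof.
move=> c0; split=> [cL e /andP[e0 ec] d d0|H].
  have : ((c - e)%:E < ereal_sup (M_ f x @` [set r | (0 < r < d)%R]))%E.
    apply: (@lt_le_trans _ _ (c%:E)); first by rewrite lte_fin ltrBlDr ltrDl.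
    apply: (le_trans cL); apply: ereal_inf_lbound.
    exists [set r | 0 < r < d] => //.
    by exists d => //= r /=; rewrite sub0r normrN => + r0; rewrite gtr0_norm// r0 => ->.
  move=> /ereal_sup_gt[_ [r /= /andP[r0 rd] <-]].
  rewrite /M_ muleC lte_pdivlMr// -EFinM => /ereal_sup_gt[_ [y /= yr <-]].
  rewrite lte_fin => fxy; exists y; split.
  - apply: contraTneq fxy => ->; rewrite subrr normr0 -leNgt.
    by rewrite mulr_ge0// ?ltW// subr_gt0.
  - exact: le_lt_trans rd.
  - by rewrite (le_trans _ (ltW fxy))// ler_wpM2l// subr_ge0 ltW.
apply: le_ereal_inf_tmp => _ [V [d /= d0 dV] <-].
(* The cap [c / 2] keeps [e'] below [c], as the hypothesis demands. *)
apply/lee_addgt0Pr => e e0; pose e' := Num.min e (c / 2).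
have e'c : 0 < e' < c.
  by rewrite /e' lt_min e0 divr_gt0//= gt_min ltr_pdivrMr// ltr_pMr// ltr1n orbT.
have [y [yx yd cy]] := H _ e'c _ d0.
have xy0 : 0 < `|x - y| by rewrite normr_gt0 subr_eq0 eq_sym.
apply: (@le_trans _ _ (M_ f x `|x - y|%R + e%:E)%E).
  rewrite -leeBlDr// -EFinB; apply: le_trans (le_M_ f _); last by rewrite eq_sym.
  rewrite lee_fin ler_pdivlMr//; apply: le_trans cy.
  by rewrite ler_pM2r// lerB// ge_min lexx.
rewrite leeD2r//; apply: ereal_sup_ubound; exists `|x - y| => //.
by apply: dV => //=; rewrite sub0r normrN normr_id.
Qed.

End LipE.

(** * Null sets from Vitali's covering theorem *)

Section small_ratio.
Context {R : realType}.
Notation mu := (@lebesgue_measure R).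
Implicit Types (nu : {measure set (measurableTypeR R) -> \bar R}).
Implicit Types (A : set R) (a b c d e r x : R).

(** The point [x] may be an endpoint of the interval, as happens for one-sided difference
    quotients. *)
Definition small_ratio nu A := forall x, A x -> forall e d, 0 < e -> 0 < d ->
  exists a b, [/\ a < b, a <= x <= b, b - a < d &
    (nu `[a, b]%classic <= (e * (b - a))%:E)%E].

Lemma lebesgue_measure_cc a b : a <= b -> mu `[a, b]%classic = (b - a)%:E.
Proof.
rewrite le_eqVlt => /predU1P[->|ab]; first by rewrite set_itv1 lebesgue_measure_set1 subrr.
by rewrite lebesgue_measure_itv/= lte_fin ab -EFinB.
Qed.

(* center and radius of the n-th rational ball: vitali_theorem only accepts
   countable families of balls, with positive radii *)
Definition rat_ball (n : nat) : R * R :=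
  let p : rat * rat := odflt (0, 1) (unpickle n) in
  (ratr p.1, if 0 < p.2 then ratr p.2 else 1).

Lemma rat_ball_gt0 n : 0 < (rat_ball n).2.
Proof. by rewrite /rat_ball/=; case: ifPn => // p0; rewrite ltr0q. Qed.

Lemma rat_ball_dense c r d : 0 < r -> 0 < d ->
  exists n, `|(rat_ball n).1 - c| < d /\ r < (rat_ball n).2 < r + d.
Proof.
move=> r0 d0.
have [p] : exists p : rat, ratr p \in `]c - d, c + d[.
  by apply: rat_in_itvoo; rewrite ltrD2l gtrN.
have [q] : exists q : rat, ratr q \in `]r, r + d[.
  by apply: rat_in_itvoo; rewrite ltrDl.
rewrite !in_itv/= => rq pc; exists (pickle (p, q)).
rewrite /rat_ball pickleK/= ltr_distl pc.
by rewrite -(ltr0q R) (lt_trans r0)//; case/andP: rq.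
Qed.

(** The interval is enlarged to a rational ball having [x] in its interior; since [nu <= mu], the
    two added strips cost at most their length. *)
Lemma small_ratio_rat_ball nu A x e d :
  (forall B, measurable B -> (nu B <= mu B)%E) -> small_ratio nu A -> A x ->
  0 < e -> 0 < d -> exists n,
    [/\ `|x - (rat_ball n).1| < (rat_ball n).2, (rat_ball n).2 < d &
        (nu (closed_ball (rat_ball n).1 (rat_ball n).2)
         <= (e * (2 * (rat_ball n).2))%:E)%E].
Proof.
move=> numu nuA Ax e0 d0.
have e20 : 0 < e / 2 by rewrite divr_gt0.
have [a [b [ab /andP[ax xb] bad nuab]]] := nuA x Ax _ _ e20 d0.
have ba0 : 0 < b - a by rewrite subr_gt0.
(* The diameter grows by less than [4 * s], so the strips cost at most [e / 2 * (b - a)], and the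
   radius stays below [3 / 4 * (b - a) < d]. *)
pose s := Num.min (e / 8) (1 / 8) * (b - a).
have s0 : 0 < s by rewrite mulr_gt0// lt_min !divr_gt0.
have se : s <= e / 8 * (b - a) by rewrite ler_wpM2r ?ge_min ?lexx// ltW.
have s1 : s <= 1 / 8 * (b - a) by rewrite ler_wpM2r ?ge_min ?lexx ?orbT// ltW.
have r0 : 0 < (b - a) / 2 + s by rewrite addr_gt0// divr_gt0.
have [n H] := rat_ball_dense ((a + b) / 2) r0 s0; exists n; move: H.
case: (rat_ball n) (rat_ball_gt0 n) => c r /= {}r0.
rewrite ltr_distl => -[/andP[ca cb] /andP[rl ru]].
have [cra bcr] : c - r < a /\ b < c + r by split; lra.
split; first (by rewrite ltr_distl; apply/andP; split; lra); first by lra.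
rewrite closed_ball_itv//.
have sub : `[c - r, c + r] `<=` `[a, b] `|` (`[c - r, a] `|` `[b, c + r]).
  move=> y /=; rewrite !in_itv/= => /andP[-> ->]; rewrite andbT/=.
  case: (leP y a); case: (leP b y) => ? ?;
    [by right; left|by right; left|by right; right|by left; rewrite !ltW].
apply: (@le_trans _ _ (nu (`[a, b] `|` (`[c - r, a] `|` `[b, c + r])))).
  apply: le_measure => //; rewrite inE; first exact: measurable_itv.
  by do 2?apply: measurableU; exact: measurable_itv.
apply: (le_trans (measureU2 _ _ _)) => //; first by apply: measurableU; exact: measurable_itv.
apply: (le_trans (leeD2l _ (measureU2 _ _ _))) => //.
apply: (le_trans (leeD nuab (leeD (numu _ _) (numu _ _)))) => //.
have er : e * ((b - a) / 2) <= e * r by rewrite ler_wpM2l ?ltW//; lra.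
rewrite (lebesgue_measure_cc (ltW cra)) (lebesgue_measure_cc (ltW bcr)).
rewrite -!EFinD lee_fin; lra.
Qed.

(** Boundedness of [A] confines the Vitali balls to an interval of finite length, so a small ratio
    yields a small total mass. *)
Lemma small_ratio_null_bounded nu A (N : R) : measurable A ->
  (forall B, measurable B -> (nu B <= mu B)%E) -> small_ratio nu A ->
  A `<=` ball 0 N -> nu A = 0%E.
Proof.
move=> mA numu nuA AN.
have [->|/set0P[x0 Ax0]] := eqVneq A set0; first by rewrite measure0.
have N0 : 0 < N by have := AN _ Ax0; rewrite -ball_normE/=; exact: le_lt_trans.
apply/eqP; rewrite eq_le measure_ge0 andbT; apply/lee_addgt0Pr => e e0; rewrite add0e.
(* Centres within [N + 1] of 0 and radii below 1 keep all the balls in [I], whose length is [K]. *)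
pose L := N + 2; pose K := 2 * L; pose I := `[- L, L]%classic.
have L0 : 0 < L by rewrite addr_gt0.
have K0 : 0 < K by rewrite mulr_gt0.
pose B n := ball (rat_ball n).1 (rat_ball n).2.
have radB n : (radius (B n))%:num = (rat_ball n).2.
  by rewrite radius_ball_num// ltW// rat_ball_gt0.
pose V := [set n | [/\ `|(rat_ball n).1| < N + 1, (rat_ball n).2 < 1 &
  (nu (closed_ball (rat_ball n).1 (rat_ball n).2)
     <= (e / K * (2 * (rat_ball n).2))%:E)%E]].
have B0 n : 0 < (radius (B n))%:num by rewrite radB rat_ball_gt0.
have [|D [cD DV tD muD]] := @vitali_theorem R A B B0 V.
  split=> [i|x Ax d d0]; first exact: is_ball_ball.
  have d'0 : 0 < Num.min d 1 by rewrite lt_min d0 ltr01.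
  have [n [xn nd nun]] := small_ratio_rat_ball numu nuA Ax (divr_gt0 e0 K0) d'0.
  move: nd; rewrite lt_min => /andP[nd n1].
  have nN : `|(rat_ball n).1| < N + 1.
    have xN : `|x| < N by have := AN _ Ax; rewrite -ball_normE/= sub0r normrN.
    rewrite -(subrK x (rat_ball n).1) (le_lt_trans (ler_normD _ _))//.
    by rewrite distrC addrC ltrD// (lt_trans xn).
  by exists n; rewrite radB; split => //; rewrite /B -ball_normE /= distrC.
pose C n := closure (B n).
have CE n : C n = `[(rat_ball n).1 - (rat_ball n).2, (rat_ball n).1 + (rat_ball n).2]%classic.
  by rewrite /C /B closure_ballE closed_ball_itv// rat_ball_gt0.
have mC n : measurable (C n : set (measurableTypeR R)).
  by rewrite CE; exact: measurable_itv.
have mUC : measurable (\bigcup_(n in D) C n : set (measurableTypeR R)).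
  by apply: bigcup_measurable => n _; exact: mC.
have UCN : \bigcup_(n in D) C n `<=` I.
  move=> x [n Dn]; rewrite CE; have [+ + _] := DV _ Dn.
  rewrite /I; case: (rat_ball n) => c r /=; rewrite !in_itv/= ltr_norml.
  by rewrite /L => /andP[? ?] ? /andP[? ?]; apply/andP; split; lra.
(* The closed balls are disjoint and lie in [I], so their total length is at most [K] and their
   [nu]-mass at most [e / K * K]. *)
have nuUC : (nu (\bigcup_(n in D) C n) <= e%:E)%E.
  rewrite measure_bigcup//.
  apply: (@le_trans _ _ (\sum_(0 <= n <oo | n \in D) ((e / K)%:E * mu (C n))))%E.
    apply: lee_nneseries => // n /set_mem Dn.
    have [_ _] := DV _ Dn; rewrite -closure_ballE => /le_trans; apply.
    rewrite CE; case: (rat_ball n) (rat_ball_gt0 n) => c r /= r0.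
    rewrite lebesgue_measure_cc; last by lra.
    rewrite -EFinM lee_fin ler_wpM2l ?(ltW (divr_gt0 e0 K0))//; lra.
  rewrite nneseriesZl; last by move=> *; exact: measure_ge0.
  rewrite -measure_bigcup//.
  apply: (@le_trans _ _ ((e / K)%:E * mu I))%E.
    rewrite lee_pmul2l ?lte_fin ?divr_gt0//.
    by apply: le_measure => //; rewrite inE//; exact: measurable_itv.
  rewrite lebesgue_measure_cc -?EFinM ?lee_fin; last by lra.
  by rewrite opprK -mulr2n -mulr_natl divfK// gt_eqF.
(* What the balls leave of [A] is [mu]-null by Vitali, hence [nu]-null. *)
apply: (@le_trans _ _ (nu (A `\` \bigcup_(n in D) C n) + nu (\bigcup_(n in D) C n)))%E.
  apply: le_trans (measureU2 _ _ _) => //; last exact: measurableD.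
  apply: le_measure; rewrite ?inE//.
    by apply: measurableU => //; exact: measurableD.
  by move=> x Ax; have [|] := pselect ((\bigcup_(n in D) C n) x); [right|left].
rewrite (_ : nu (_ `\` _) = 0%E) ?add0e//.
apply/eqP; rewrite eq_le measure_ge0 andbT -[leRHS]muD.
by apply: numu; exact: measurableD.
Qed.

Lemma small_ratio_null nu A : measurable A ->
  (forall B, measurable B -> (nu B <= mu B)%E) -> small_ratio nu A -> nu A = 0%E.
Proof.
move=> mA numu nuA.
pose F n := A `&` ball 0 n%:R.
have AF : A `<=` \bigcup_n F n.
  move=> x Ax; exists (Num.bound `|x|) => //; split => //.
  rewrite -ball_normE /= sub0r normrN; exact: archi_boundP.
have mF n : measurable (F n : set (measurableTypeR R)).
  by apply: measurableI => //; exact: measurable_ball.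
apply/eqP; rewrite eq_le measure_ge0 andbT.
apply: (le_trans (measure_sigma_subadditive nu mF mA AF)).
rewrite eseries0// => n _ _; apply: (@small_ratio_null_bounded _ _ n%:R) => //.
- exact: mF.
- by move=> x [Ax _]; exact: nuA.
- exact: subIsetr.
Qed.

End small_ratio.

(** * Lebesgue measure as a sum of two Stieltjes measures *)

Section stieltjes_decomposition.
Context {R : realType}.
Notation mu := (@lebesgue_measure R).
Implicit Types (F : R -> R) (a b x y : R) (A E : set R).

(** The two bounds say that [F] and [x - F x] are both nondecreasing, so that each has a Stieltjes
    measure. *)
Definition slope01 F := forall x y, x <= y -> 0 <= F y - F x <= y - x.

Lemma slope01_dist F x y : slope01 F -> `|F x - F y| <= `|x - y|.
Proof.
wlog xy : x y / x <= y.
  by move=> h F01; have [/h|/ltW/h] := leP x y; [exact|rewrite distrC (distrC x); exact].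
move=> /(_ _ _ xy) /andP[F0 F1].
by rewrite distrC (distrC x) !ger0_norm// subr_ge0.
Qed.

Lemma slope01_homo F : slope01 F -> {homo F : x y / x <= y}.
Proof. by move=> F01 x y /F01/andP[]; rewrite subr_ge0. Qed.

Lemma slope01_continuous F : slope01 F -> continuous F.
Proof.
move=> F01 x; apply/cvgrPdist_lt => e e0; near=> y.
by apply: le_lt_trans (slope01_dist _ _ F01) _; near: y; apply: cvgr_dist_lt.
Unshelve. all: by end_near. Qed.

Lemma slope01_id_sub F : slope01 F -> slope01 (fun x => x - F x).
Proof. by move=> F01 x y /F01; lra. Qed.

Lemma stieltjes_ocitv F : slope01 F ->
  exists nu : {measure set (measurableTypeR R) -> \bar R},
    forall a b, a <= b -> nu `]a, b]%classic = (F b - F a)%:E.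
Proof.
move=> F01; have rcF := right_continuousW (slope01_continuous F01).
pose f : cumulative R R :=
  HB.pack F (isCumulative.Build R _ R F (slope01_homo F01) rcF).
exists (lebesgue_stieltjes_measure f) => a b ab.
apply: etrans (@wlength_itv_bnd R F a b false false ab).
exact: (measurable_mu_extE (wlength f) (is_ocitv a b)).
Qed.

(** The Stieltjes measures of [F] and [x - F x] add up to the length on half-open intervals, and
    Lebesgue measure is determined by these. *)
Lemma stieltjes_decomposition F : slope01 F ->
  exists nu nu' : {measure set (measurableTypeR R) -> \bar R},
    [/\ forall a b, a <= b -> nu `[a, b]%classic = (F b - F a)%:E,
        forall a b, a <= b -> nu' `[a, b]%classic = (b - a - (F b - F a))%:E &
        forall A, measurable A -> mu A = (nu A + nu' A)%E].
Proof.
move=> F01.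
have [nu nuE] := stieltjes_ocitv F01.
have [nu' nu'E] := stieltjes_ocitv (slope01_id_sub F01).
pose m : {measure set (measurableTypeR R) -> \bar R} := measure_add nu nu'.
have mE A : m A = (nu A + nu' A)%E by exact: measure_addE.
have muE A : measurable A -> mu A = (nu A + nu' A)%E.
  move=> mA; rewrite -mE; apply: lebesgue_measure_unique => // _ [[a b] _ <-] /=.
  rewrite lebesgue_measure_itv/= lte_fin mE; case: ltP => ab.
    by rewrite (nuE _ _ (ltW ab)) (nu'E _ _ (ltW ab)) -!EFinD; congr EFin; lra.
  by rewrite set_itv_ge ?bnd_simp -?leNgt// !measure0 adde0.
(* A measure below [mu] does not charge points, so adding the left endpoint changes nothing. *)
have ccE (k : {measure set (measurableTypeR R) -> \bar R}) G :
    (forall A, measurable A -> (k A <= mu A)%E) ->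
    (forall a b, a <= b -> k `]a, b]%classic = (G b - G a)%:E) ->
    forall a b, a <= b -> k `[a, b]%classic = (G b - G a)%:E.
  move=> kmu kG a b ab.
  rewrite -(setU1itv false)//.
  rewrite measureU//=; last first.
    by apply/seteqP; split=> // x [/= ->]; rewrite in_itv/= ltxx.
  rewrite kG// (_ : k [set a] = 0%E) ?add0e//.
  by apply/eqP; rewrite eq_le measure_ge0 andbT -(lebesgue_measure_set1 a) kmu.
exists nu, nu'; split=> //.
  by apply: ccE => // A mA; rewrite muE// leeDl.
move=> a b ab; rewrite (ccE nu' (fun x => x - F x))//; first by congr EFin; lra.
by move=> A mA; rewrite muE// leeDr.
Qed.

(** The two hypotheses are small ratios for [nu] off [E] and for [nu'] on [E]: [nu] is carried by
    [E] and [nu'] by its complement. *)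
Lemma lebesgue_measure_setI_increment F E : slope01 F -> measurable E ->
  (forall x, ~ E x -> forall e d, 0 < e -> 0 < d -> exists a b,
     [/\ a < b, a <= x <= b, b - a < d & F b - F a <= e * (b - a)]) ->
  (forall x, E x -> forall e d, 0 < e -> 0 < d -> exists a b,
     [/\ a < b, a <= x <= b, b - a < d & (1 - e) * (b - a) <= F b - F a]) ->
  forall a b, a <= b -> mu (E `&` `[a, b]) = (F b - F a)%:E.
Proof.
move=> F01 mE FE' FE a b ab.
have [nu [nu' [nuE nu'E muE]]] := stieltjes_decomposition F01.
have nu_le A : measurable A -> (nu A <= mu A)%E by move=> mA; rewrite muE// leeDl.
have nu'_le A : measurable A -> (nu' A <= mu A)%E by move=> mA; rewrite muE// leeDr.
have nu0 : nu (~` E) = 0%E.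
  apply: (small_ratio_null (measurableC mE) nu_le).
  move=> x Ex e d e0 d0; have [u [v [uv xuv vud Fuv]]] := FE' _ Ex _ _ e0 d0.
  by exists u, v; split=> //; rewrite (nuE _ _ (ltW uv)).
have nu'0 : nu' E = 0%E.
  apply: (small_ratio_null mE nu'_le).
  move=> x Ex e d e0 d0; have [u [v [uv xuv vud Fuv]]] := FE _ Ex _ _ e0 d0.
  by exists u, v; split=> //; rewrite (nu'E _ _ (ltW uv)) lee_fin; lra.
have mI : measurable `[a, b]%classic by exact: measurable_itv.
have mEI : measurable (E `&` `[a, b]) by exact: measurableI.
have mE'I : measurable (~` E `&` `[a, b]).
  by apply: measurableI => //; exact: measurableC.
rewrite muE// (_ : nu' _ = 0%E) ?adde0; last first.
  apply/eqP; rewrite eq_le measure_ge0 andbT -[leRHS]nu'0.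
  by apply: le_measure; rewrite ?inE.
(* The increment is [nu] of [[a, b]], which is split along [E] and its [nu]-null complement. *)
rewrite -nuE// -[in RHS](setTI `[a, b]%classic) -(setUv E) setIUl measureU//=.
  rewrite (_ : nu (~` E `&` _) = 0%E) ?adde0//.
  apply/eqP; rewrite eq_le measure_ge0 andbT -[leRHS]nu0.
  by apply: le_measure; rewrite ?inE//; exact: measurableC.
by apply/seteqP; split=> // x [[? _] []].
Qed.

End stieltjes_decomposition.

(** * Density expressed by interval endpoints *)

Section density.
Context {R : realType}.
Implicit Types (S E A X : set R) (a b c d e x : R) (I : (set R)^nat).

(** Real-valued, so that density becomes real arithmetic; by [meas_inE], [fine] loses nothing when
    [a <= b]. *)
Definition meas_in S a b : R := fine (Lebesgue (S `&` `[a, b])).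

Lemma Lebesgue_cc a b : a <= b -> Lebesgue `[a, b]%classic = (b - a)%:E.
Proof. exact: lebesgue_measure_cc. Qed.

(** [Lebesgue] unfolds to the outer measure generated by interval length, hence is monotone on
    arbitrary sets. *)
Lemma le_Lebesgue A X : A `<=` X -> (Lebesgue A <= Lebesgue X)%E.
Proof. exact: (le_outer_measure (@wlength R idfun)^*%mu). Qed.

Lemma Lebesgue_ge0 A : (0 <= Lebesgue A)%E.
Proof. exact: (outer_measure_ge0 (@wlength R idfun)^*%mu). Qed.

Lemma Lebesgue_split E X : Lebesgue_measurable E ->
  Lebesgue X = (Lebesgue (X `&` E) + Lebesgue (X `&` ~` E))%E.
Proof. by move=> /(_ X). Qed.

Lemma measurable_Lebesgue_measurable A : measurable A -> Lebesgue_measurable A.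
Proof. exact: sub_caratheodory. Qed.

Lemma Lebesgue_measurableC E : Lebesgue_measurable E -> Lebesgue_measurable (~` E).
Proof. exact: measurableC. Qed.

Lemma meas_inE S a b : a <= b -> Lebesgue (S `&` `[a, b]) = (meas_in S a b)%:E.
Proof.
move=> ab; rewrite /meas_in fineK// ge0_fin_numE ?Lebesgue_ge0//.
apply: (@le_lt_trans _ _ (Lebesgue `[a, b]%classic)).
  by apply: le_Lebesgue; exact: subIsetr.
by rewrite Lebesgue_cc// ltry.
Qed.

Lemma meas_in_le S a b : a <= b -> meas_in S a b <= b - a.
Proof.
move=> ab; rewrite -lee_fin -meas_inE// -Lebesgue_cc//.
by apply: le_Lebesgue; exact: subIsetr.
Qed.

Lemma meas_inC E a b : Lebesgue_measurable E -> a <= b ->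
  meas_in (~` E) a b = b - a - meas_in E a b.
Proof.
move=> mE ab; have := Lebesgue_split `[a, b]%classic mE.
rewrite Lebesgue_cc// !(setIC `[a, b]%classic) !meas_inE// -EFinD => -[]; lra.
Qed.

Lemma meas_in_ratioE S a b : a < b ->
  (Lebesgue (S `&` `[a, b]) / Lebesgue `[a, b]%classic)%E
    = (meas_in S a b / (b - a))%:E.
Proof.
move=> ab; rewrite meas_inE ?Lebesgue_cc ?ltW// inver subr_eq0 gt_eqF//.
Qed.

Lemma intervals_toP I x : intervals_to I x ->
  exists u v : nat -> R, [/\ forall n, u n < v n, forall n, u n <= x <= v n,
    forall n, I n = `[u n, v n]%classic &
    forall d, 0 < d -> \forall n \near \oo, v n - u n < d].
Proof.
move=> [cI Ix I0].
have /choice[p pP] n : exists p : R * R, p.1 < p.2 /\ I n = `[p.1, p.2]%classic.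
  by have [a [b [ab IE]]] := cI n; exists (a, b).
exists (fst \o p), (snd \o p); split=> [n|n|n|d d0] /=; try by have [] := pP n.
  by have := Ix n; rewrite (pP n).2/= in_itv.
move/fine_cvgP : I0 => [_ /cvgr0Pnorm_lt/(_ d d0)].
apply: filterS => n /=; have [uv ->] := pP n.
by rewrite Lebesgue_cc ?ltW//= => /(le_lt_trans (ler_norm _)).
Qed.

Lemma intervals_to_cc (u v : nat -> R) x :
  (forall n, u n < v n) -> (forall n, u n <= x <= v n) ->
  (forall n, v n - u n < n.+1%:R^-1) ->
  intervals_to (fun n => `[u n, v n]%classic) x.
Proof.
move=> uv uxv uv0; split=> [n|n|]; first by exists (u n), (v n).
  by rewrite /= in_itv/= uxv.
apply/fine_cvgP; split.
  by apply: nearW => n; rewrite Lebesgue_cc ?ltW.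
apply/cvgr0Pnorm_lt => e e0.
have := @near_infty_natSinv_lt R (PosNum e0); apply: filterS => n /=.
rewrite Lebesgue_cc ?(ltW (uv n))//= ger0_norm ?subr_ge0 ?(ltW (uv n))//.
exact: lt_trans.
Qed.

(** The ratio never exceeds 1, so convergence to 1 is only a matter of lower bounds. *)
Lemma density_to1P S (u v : nat -> R) : (forall n, u n < v n) ->
  density_to1 S (fun n => `[u n, v n]%classic) <->
  forall e, 0 < e -> \forall n \near \oo, (1 - e) * (v n - u n) <= meas_in S (u n) (v n).
Proof.
move=> uv; have vu0 n : 0 < v n - u n by rewrite subr_gt0.
rewrite /density_to1 [X in X @ \oo](_ : _ = fun n => (meas_in S (u n) (v n) / (v n - u n))%:E); last first.
  by apply/funext => n; exact: meas_in_ratioE.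
split=> [/fine_cvgP[_ /cvgrPdist_le H] e /H|H].
  apply: filterS => n /=; rewrite ler_norml => /andP[_].
  by rewrite lerBlDr -lerBlDl ler_pdivlMr.
apply/fine_cvgP; split; first exact: nearW.
apply/cvgrPdist_le => e e0; apply: filterS (H _ e0) => n /= h.
rewrite ger0_norm; first by rewrite lerBlDr -lerBlDl ler_pdivlMr.
by rewrite subr_ge0 ler_pdivrMr// mul1r meas_in_le// ltW.
Qed.

(** If no [d] worked for some [e], bad intervals of length below [1 / (n + 1)] could be chosen for
    each [n]; they shrink to [x] with ratio below [1 - e]. *)
Lemma strongly_dense_atP S x : strongly_dense_at S x <->
  forall e, 0 < e -> exists2 d, 0 < d & forall a b, a <= x <= b -> a < b ->
    b - a < d -> (1 - e) * (b - a) <= meas_in S a b.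
Proof.
split=> [Sx e e0|H I Ix].
  apply: contrapT => /forall2NP H.
  have /choice[p pP] (n : nat) : exists p : R * R, [/\ p.1 < p.2, p.1 <= x <= p.2,
      p.2 - p.1 < n.+1%:R^-1 & meas_in S p.1 p.2 < (1 - e) * (p.2 - p.1)].
    have [|] := H (n.+1%:R^-1); first by case; rewrite invr_gt0.
    move=> /existsNP[a /existsNP[b /not_implyP[axb /not_implyP[ab /not_implyP[abd /negP]]]]].
    by rewrite -ltNge => h; exists (a, b).
  have up n : (fst \o p) n < (snd \o p) n by have [] := pP n.
  have := Sx _ (intervals_to_cc up (fun n => let: And4 _ h _ _ := pP n in h)
    (fun n => let: And4 _ _ h _ := pP n in h)).
  move=> /(density_to1P _ up)/(_ _ e0)[N _ /(_ N (leqnn _))]/=.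
  by have [_ _ _] := pP N; rewrite ltNge => /negP.
have [u [v [uv uxv IE uv0]]] := intervals_toP Ix.
have -> : I = (fun n => `[u n, v n]%classic) by apply/funext.
apply/density_to1P => // e /H[d d0 dH].
by apply: filterS (uv0 d d0) => n; exact: dH.
Qed.

(** The sequence is obtained diagonally, with [e] and [d] both equal to [1 / (n + 1)]. *)
Lemma weakly_dense_atP S x : weakly_dense_at S x <->
  forall e d, 0 < e -> 0 < d -> exists a b, [/\ a < b, a <= x <= b,
    b - a < d & (1 - e) * (b - a) <= meas_in S a b].
Proof.
split=> [[I [Ix SI]] e d e0 d0|H].
  have [u [v [uv uxv IE uv0]]] := intervals_toP Ix.
  have IE' : I = (fun n => `[u n, v n]%classic) by apply/funext.
  move: SI; rewrite IE' => /(density_to1P _ uv)/(_ _ e0) SI.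
  have [N _ /(_ N (leqnn _))[]] := filterI (uv0 _ d0) SI.
  by exists (u N), (v N).
have n0 (n : nat) : 0 < n.+1%:R^-1 :> R by rewrite invr_gt0.
have /choice[p pP] (n : nat) : exists p : R * R, [/\ p.1 < p.2, p.1 <= x <= p.2,
    p.2 - p.1 < n.+1%:R^-1 & (1 - n.+1%:R^-1) * (p.2 - p.1) <= meas_in S p.1 p.2].
  by have [a [b [? ? ? ?]]] := H _ _ (n0 n) (n0 n); exists (a, b).
have up n : (fst \o p) n < (snd \o p) n by have [] := pP n.
eexists; split.
  exact: (intervals_to_cc up (fun n => let: And4 _ h _ _ := pP n in h)
    (fun n => let: And4 _ _ h _ := pP n in h)).
apply/density_to1P => // e e0.
have := @near_infty_natSinv_lt R (PosNum e0); apply: filterS => n /= ne.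
have [_ _ _] := pP n; apply: le_trans.
by apply: ler_wpM2r; [rewrite subr_ge0 (ltW (up n))|rewrite lerD2l lerN2 ltW].
Qed.

End density.

(** * [Lip] of a primitive and density *)

Section Lip_primitive.
Context {R : realType}.
Implicit Types (f F g : R -> R) (E : set R) (a b c d e x y : R).

Lemma Lip_ge0 f x : (0 <= Lip f x)%E.
Proof.
apply: le_ereal_inf_tmp => _ [V [d /= d0 dV] <-].
have d20 : 0 < d / 2 by rewrite divr_gt0.
apply: (@le_trans _ _ (M_ f x (d / 2))); last first.
  apply: ereal_sup_ubound; exists (d / 2) => //; apply: dV => //=.
  by rewrite sub0r normrN gtr0_norm//; lra.
(* The choice [y = x] puts 0 among the values of the supremum. *)
rewrite /M_ lee_pdivlMl// mule0 (_ : 0%E = `|f x - f x|%:E) ?subrr ?normr0//.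
by apply: ereal_sup_ubound; exists x => //=; rewrite subrr normr0// ltW.
Qed.

(** Reduces nonincreasing functions to nondecreasing ones. *)
Lemma LipN f x : Lip (fun y => - f y) x = Lip f x.
Proof.
rewrite /Lip (_ : M_ (fun y => - f y) x = M_ f x)//; apply/funext => r.
rewrite /M_; congr (_ * ereal_sup _)%E.
by apply: eq_imagel => y _; rewrite -opprD normrN.
Qed.

Lemma slope01_Lip_le1 F x : slope01 F -> (Lip F x <= 1)%E.
Proof.
move=> F01; apply/Lip_leP => // e e0; exists 1 => // y _.
by rewrite (le_trans (slope01_dist _ _ F01))// ler_peMl// lerDl ltW.
Qed.

(** Cutting [[a, b]] at [x] and adding the bounds on the two increments gives one direction;
    intervals with endpoint [x] give the other. *)
Lemma slope01_Lip_le0P F x : slope01 F ->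
  (Lip F x <= 0)%E <->
  forall e, 0 < e -> exists2 d, 0 < d & forall a b, a <= x <= b -> a < b ->
    b - a < d -> F b - F a <= e * (b - a).
Proof.
move=> F01; rewrite Lip_leP//; split=> H e e0.
  have [d d0 dH] := H e e0; exists d => // a b /andP[ax xb] ab abd.
  have [Fax Fxb] := (slope01_homo F01 ax, slope01_homo F01 xb).
  have Ha : F x - F a <= e * (x - a).
    have := dH a; rewrite add0r !ger0_norm ?subr_ge0//; apply; lra.
  have Hb : F b - F x <= e * (b - x).
    have := dH b; rewrite add0r distrC (distrC (F x)) !ger0_norm ?subr_ge0//.
    by apply; lra.
  by lra.
have [d d0 dH] := H e e0; exists d => // y; rewrite add0r.
have [xy|xy|->] := ltgtP x y; last by rewrite !subrr normr0 mulr0.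
  have F0 := slope01_homo F01 (ltW xy).
  rewrite distrC (distrC (F x)) !ger0_norm ?subr_ge0 ?(ltW xy)//.
  by apply: dH => //; rewrite lexx ltW.
have F0 := slope01_homo F01 (ltW xy).
rewrite !ger0_norm ?subr_ge0 ?(ltW xy)//.
by apply: dH => //; rewrite lexx ltW.
Qed.

Lemma slope01_Lip_ge1P F x : slope01 F ->
  (1 <= Lip F x)%E <->
  forall e d, 0 < e -> 0 < d -> exists a b,
    [/\ a < b, a <= x <= b, b - a < d & (1 - e) * (b - a) <= F b - F a].
Proof.
move=> F01; split=> [/(Lip_geP _ _ ltr01) H e d e0 d0|H].
  (* [Lip_geP] asks for a value below 1, while [e] may be large. *)
  have e'P : 0 < Num.min e (1 / 2) < 1.
    by rewrite lt_min gt_min e0 divr_gt0//=; apply/orP; right; lra.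
  have [y [yx yd yF]] := H _ e'P d d0.
  have {}yF : (1 - e) * `|x - y| <= `|F x - F y|.
    by apply: le_trans yF; rewrite ler_wpM2r// lerD2l lerN2 ge_min lexx.
  have [xy|xy|/eqP] := ltgtP x y; last by rewrite eq_sym (negbTE yx).
    have F0 := slope01_homo F01 (ltW xy).
    move: yd yF; rewrite distrC (distrC (F x)) !ger0_norm ?subr_ge0 ?(ltW xy)// => yd yF.
    by exists x, y; rewrite lexx ltW.
  have F0 := slope01_homo F01 (ltW xy).
  move: yd yF; rewrite !ger0_norm ?subr_ge0 ?(ltW xy)// => yd yF.
  by exists y, x; rewrite lexx ltW.
apply/Lip_geP => // e /andP[e0 _] d d0.
have [a [b [ab /andP[ax xb] abd Fab]]] := H e d e0 d0.
have [Fax Fxb] := (slope01_homo F01 ax, slope01_homo F01 xb).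
(* [a, x] or [x, b] has slope at least 1 - e, because [a, b] has *)
have [/andP[xb' h]|] := boolP ((x < b) && ((1 - e) * (b - x) <= F b - F x)).
  exists b; rewrite gt_eqF// distrC (distrC (F x)) !ger0_norm ?subr_ge0//.
  by split=> //; lra.
rewrite negb_and -leNgt -ltNge => h.
(* If [x = a], the right piece would be [[a, b]] itself, which has the required slope. *)
have ax' : a < x.
  rewrite lt_neqAle ax andbT; apply/eqP => ax'; move: h; subst a.
  by rewrite leNgt ab/= ltNge Fab.
exists a; rewrite lt_eqF// !ger0_norm ?subr_ge0//; split=> //; first by lra.
case/orP: h => [bx|h]; last by lra.
have xbE : x = b by apply/eqP; rewrite eq_le xb bx.
by rewrite xbE.
Qed.

(** Isolates the two inequalities that translate into density; the bound [0 <= Lip f x] always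
    holds. *)
Lemma Lip_eq_indic E f : (forall x, Lip f x = (\1_E x)%:E) <->
  [/\ forall x, (Lip f x <= 1)%E, forall x, E x -> (1 <= Lip f x)%E &
      forall x, ~ E x -> (Lip f x <= 0)%E].
Proof.
split=> [H|[H1 H2 H3] x].
  split=> x; rewrite H indicE.
  - by rewrite lee_fin lern1 leq_b1.
  - by move=> Ex; rewrite mem_set.
  - by move=> Ex; rewrite memNset.
rewrite indicE; apply/eqP; rewrite eq_le; have [/set_mem Ex|/negP] := boolP (x \in E).
  by rewrite H1 H2.
by rewrite inE => Ex; rewrite H3 ?Lip_ge0.
Qed.

(** The bound [Lip F <= 1] follows from [slope01]. The rest is a pointwise dictionary, in which
    [meas_inC] turns small increments of [F] into high density of the complement. *)
Lemma primitive_LipP F E : Lebesgue_measurable E ->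
  (forall a b, a <= b -> F b - F a = meas_in E a b) ->
  (forall x, Lip F x = (\1_E x)%:E) <-> weakly_dense E /\ strongly_dense (~` E).
Proof.
move=> mE FE.
have F01 : slope01 F.
  by move=> x y xy; rewrite FE// meas_in_le// fine_ge0// Lebesgue_ge0.
have wP x : weakly_dense_at E x <-> (1 <= Lip F x)%E.
  rewrite (slope01_Lip_ge1P _ F01) weakly_dense_atP; split=> H e d e0 d0.
    by have [a [b [ab ? ? h]]] := H e d e0 d0; exists a, b; rewrite (FE _ _ (ltW ab)).
  by have [a [b [ab ? ? h]]] := H e d e0 d0; exists a, b; rewrite -(FE _ _ (ltW ab)).
have sP x : strongly_dense_at (~` E) x <-> (Lip F x <= 0)%E.
  rewrite (slope01_Lip_le0P _ F01) strongly_dense_atP.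
  split=> H e e0; have [d d0 dH] := H e e0; exists d => // a b axb ab abd;
    by have := dH a b axb ab abd; rewrite (meas_inC mE (ltW ab)) (FE _ _ (ltW ab)); lra.
rewrite Lip_eq_indic; split=> [[_ H1 H0]|[[_ H1] [_ H0]]].
  split; split=> //; first by move=> x /H1 /wP.
    exact: Lebesgue_measurableC.
  by move=> x /H0 /sP.
split=> x; first exact: slope01_Lip_le1.
  by move=> /H1 /wP.
by move=> /H0 /sP.
Qed.

End Lip_primitive.

(** * From monotone functions to primitives and back *)

Section characterization.
Context {R : realType}.
Implicit Types (f F g : R -> R) (E : set R) (a b c d e x y : R).

Lemma locally_nondecreasing g :
  (forall x, exists2 d, 0 < d & forall y, `|x - y| < d ->
     (x <= y -> g x <= g y) /\ (y <= x -> g y <= g x)) ->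
  {homo g : x y / x <= y}.
Proof.
move=> H x y xy; pose S := [set t | x <= t <= y /\ g x <= g t].
have Sx : S x by split; rewrite ?lexx.
have Sy : ubound S y by move=> t [/andP[]].
have supS : has_sup S by split; [exists x|exists y].
have sy : sup S <= y by apply: ge_sup Sy; exists x.
have xs : x <= sup S by apply: ub_le_sup => //; exists y.
have [d d0 dH] := H (sup S).
have [t St ts] := sup_adherent d0 supS.
have tS : t <= sup S by apply: ub_le_sup => //; exists y.
have gs : g x <= g (sup S).
  have td : sup S - t < d by lra.
  by apply: (le_trans St.2); apply: (dH t _).2; rewrite // ger0_norm ?subr_ge0.
move: sy; rewrite le_eqVlt => /predU1P[<-//|sy].
(* A point beyond [sup S], still in [[x, y]] and within [d] of [sup S]. *)
pose u := Num.min y (sup S + d / 2).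
have su : sup S < u by rewrite lt_min sy ltrDl divr_gt0.
suff : u <= sup S by rewrite leNgt su.
apply: ub_le_sup; first by exists y.
split; first by rewrite (le_trans xs (ltW su)) ge_min lexx.
apply: (le_trans gs); apply: (dH u _).1; last exact: ltW.
rewrite distrC ger0_norm ?subr_ge0 ?(ltW su)// ltrBlDr.
have : u <= sup S + d / 2 by rewrite ge_min lexx orbT.
by lra.
Qed.

(** For every [e' > 0], [Lip f <= 1] makes [(1 + e') * z - f z] nondecreasing around each point,
    hence globally. *)
Lemma Lip_le1_slope01 f : {homo f : x y / x <= y} ->
  (forall x, (Lip f x <= 1)%E) -> slope01 f.
Proof.
move=> ndf f1 x y; rewrite le_eqVlt => /predU1P[->|xy].
  by rewrite !subrr lexx.
rewrite subr_ge0 ndf ?(ltW xy)//=; apply/ler_addgt0Pr => e e0.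
(* The excess slope [e'] costs exactly [e] over [[x, y]]. *)
pose e' := e / (y - x).
have yx0 : 0 < y - x by rewrite subr_gt0.
have e'0 : 0 < e' by rewrite divr_gt0.
suff h : {homo (fun z => (1 + e') * z - f z) : z t / z <= t}.
  have := h _ _ (ltW xy); have : e' * (y - x) = e by rewrite divfK// gt_eqF.
  by nra.
apply: locally_nondecreasing => z.
have [d d0 dH] := (@Lip_leP R f z 1 ler01).1 (f1 z) e' e'0.
exists d => // t /dH fzt; split=> [zt|tz]; move: fzt.
  have fzt := ndf _ _ zt.
  by rewrite (distrC z) (distrC (f z)) !ger0_norm ?subr_ge0// mulrBr; lra.
have ftz := ndf _ _ tz.
by rewrite !ger0_norm ?subr_ge0// mulrBr; lra.
Qed.

(** This is where the measurability of [E] comes from. The set is a countable intersection of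
    countable unions of closed sets. *)
Lemma measurable_Lip_le0 f : continuous f ->
  measurable [set x | (Lip f x <= 0)%E].
Proof.
move=> cf.
(* Indexing by the displacement [u] instead of [y = x + u] makes the index set independent of [x],
   so [C e d] is an intersection of closed sets. *)
pose C (e d : R) : set R := \bigcap_(u in [set u : R | `|u| < d])
  [set x | `|f x - f (x + u)| <= e * `|u|].
have closedC e d : closed (C e d).
  apply: closed_bigI => u _.
  have -> : [set x | `|f x - f (x + u)| <= e * `|u|]
      = (fun x => `|f x - f (x + u)|) @^-1` [set z | z <= e * `|u|] by [].
  apply: (continuous_closedP _).1; last exact: closed_le.
  move=> x; apply: cvg_norm; apply: cvgB; first exact: cf.
  apply: (@continuous_comp _ _ _ (fun x => x + u) f); last exact: cf.
  by apply: cvgD; [exact: cvg_id|exact: cvg_cst].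
have -> : [set x | (Lip f x <= 0)%E] =
    \bigcap_n \bigcup_m C n.+1%:R^-1 m.+1%:R^-1.
  apply/seteqP; split=> x /=.
    move=> /(Lip_leP _ _ (lexx 0)) H n _.
    have n0 : 0 < n.+1%:R^-1 :> R by rewrite invr_gt0.
    have [d d0 dH] := H _ n0.
    have [m _ /(_ m (leqnn m)) md] := near_infty_natSinv_lt (PosNum d0).
    exists m => // u /= um; have := dH (x + u).
    rewrite add0r opprD addNKr normrN; apply; exact: lt_trans md.
  move=> H; apply/Lip_leP => // e e0.
  have [n _ /(_ n (leqnn n)) /= ne] := near_infty_natSinv_lt (PosNum e0).
  have [m _ mC] := H n I.
  exists m.+1%:R^-1; first by rewrite invr_gt0.
  move=> y xy; have := mC (y - x).
  rewrite /= (addrC x) subrK (distrC y) add0r => /(_ xy) h.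
  by apply: (le_trans h); rewrite ler_wpM2r// ltW.
apply: bigcapT_measurable => n; apply: bigcupT_measurable => m.
exact: closed_measurable.
Qed.

(** Once [E] is known to be Borel, [f] is shown to be a primitive of its indicator, and
    [primitive_LipP] concludes. *)
Lemma nondecreasing_Lip1_dense f E : continuous f -> {homo f : x y / x <= y} ->
  (forall x, Lip f x = (\1_E x)%:E) -> weakly_dense E /\ strongly_dense (~` E).
Proof.
move=> cf ndf fE; have [f1 f1E f0E] := (Lip_eq_indic E f).1 fE.
have f01 := Lip_le1_slope01 ndf f1.
have mE : measurable E.
  rewrite -(setCK E) (_ : ~` E = [set x | (Lip f x <= 0)%E]).
    by apply: measurableC; exact: measurable_Lip_le0.
  apply/seteqP; split=> [x /f0E//|x /= fx0 /f1E].
  by rewrite leNgt (le_lt_trans fx0).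
apply/(@primitive_LipP R f E) => //; first exact: measurable_Lebesgue_measurable.
move=> a b ab; apply/EFin_inj; rewrite -meas_inE// -(lebesgue_measure_setI_increment f01 mE)//.
- move=> x /f0E /(slope01_Lip_le0P _ f01) H e d e0 d0.
  (* The interval [[x, x + h]] is shorter than both the prescribed [d] and the [d'] at which the
     slope is at most [e]. *)
  have [d' d'0 d'H] := H e e0; pose h := Num.min d d' / 2.
  have dd' : 0 < Num.min d d' by rewrite lt_min d0.
  have [hd hd'] : h < d /\ h < d'.
    have : Num.min d d' <= d by rewrite ge_min lexx.
    have : Num.min d d' <= d' by rewrite ge_min lexx orbT.
    by rewrite /h; split; lra.
  have h0 : 0 < h by rewrite divr_gt0.
  exists x, (x + h); split; rewrite ?lexx ?ltrDl//=; first by rewrite lerDl ltW.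
    by rewrite addrC addKr.
  by apply: d'H; rewrite ?lexx ?ltrDl ?lerDl ?(ltW h0)//; rewrite addrC addKr.
- by move=> x /f1E /(slope01_Lip_ge1P _ f01).
Qed.

Lemma meas_in_split E a b c : a <= b -> b <= c ->
  meas_in E a c = meas_in E a b + meas_in E b c.
Proof.
move=> ab bc; apply/EFin_inj; rewrite EFinD -!meas_inE ?(le_trans ab)//.
have mI (i : interval R) : Lebesgue_measurable [set` i].
  by apply: measurable_Lebesgue_measurable; exact: measurable_itv.
rewrite (Lebesgue_split _ (mI `[a, b])); congr (_ + _)%E.
  congr Lebesgue; rewrite -setIA; congr (_ `&` _); apply/seteqP; split=> x [] //=.
  by rewrite !in_itv/= => /andP[-> xb]; rewrite xb (le_trans xb).
(* The first cut left [E] on []b, c]]; removing the null set [[b, b]] from [[b, c]] leaves the same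
   set. *)
rewrite [RHS](Lebesgue_split _ (mI `[b, b])).
rewrite (_ : Lebesgue (_ `&` _ `&` `[b, b]) = 0%E) ?add0e; last first.
  apply/eqP; rewrite eq_le Lebesgue_ge0 andbT.
  apply: (le_trans (le_Lebesgue (@subIsetr _ _ _))).
  by rewrite Lebesgue_cc// subrr.
congr Lebesgue; rewrite -!setIA; congr (_ `&` _); apply/seteqP; split=> x /=.
  rewrite !in_itv/= => -[/andP[ax xc]] /negP; rewrite ax/= -ltNge => bx.
  by rewrite (ltW bx) xc; split=> // /andP[_]; rewrite leNgt bx.
rewrite !in_itv/= => -[/andP[bx xc] nb]; rewrite (le_trans ab bx) xc; split=> // xb.
by apply: nb; rewrite bx.
Qed.

(** The oriented integral of the indicator of [E] from 0 to [x]. A finite base point is taken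
    because [E] may have infinite measure on a half-line. *)
Definition measure_from0 E x := if 0 <= x then meas_in E 0 x else - meas_in E x 0.

Lemma measure_from0B E a b : a <= b ->
  measure_from0 E b - measure_from0 E a = meas_in E a b.
Proof.
rewrite /measure_from0 => ab; case: leP => [b0|b0]; case: leP => a0.
- by rewrite (meas_in_split E a0 ab) addrC addKr.
- by rewrite opprK addrC -meas_in_split// ltW.
- by have := le_lt_trans (le_trans a0 ab) b0; rewrite ltxx.
- by rewrite opprK (meas_in_split E ab (ltW b0)) addrC addrK.
Qed.

End characterization.

Theorem theorem3p1 (R : realType) (E : set R) :
  monotone_Lip1 E <-> weakly_dense E /\ strongly_dense (~` E).
Proof.
split=> [[f [cf [ndf|nif] fE]]|dE]; first exact: nondecreasing_Lip1_dense fE.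
  apply: (@nondecreasing_Lip1_dense R (fun x => - f x)) => [x|x y /nif|x].
  - by apply: cvgN; exact: cf.
  - by rewrite lerN2.
  - by rewrite LipN.
(* For the converse, the witness is the primitive of the indicator of [E] that vanishes at 0. *)
have FE a b : a <= b -> measure_from0 E b - measure_from0 E a = meas_in E a b.
  exact: measure_from0B.
have F01 : slope01 (measure_from0 E).
  by move=> x y xy; rewrite FE// meas_in_le// fine_ge0// Lebesgue_ge0.
exists (measure_from0 E); split.
- exact: slope01_continuous.
- by left; exact: slope01_homo.
- exact/(primitive_LipP dE.1.1 FE).
Qed.
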